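(* Consider the Bass model on the homogeneous complete network with $M$ nodes as $M\to\infty$. Then the optimal promotion $\mathbf{s}^{\rm opt}:=(s_p^{\rm opt},s_q^{\rm opt})$, i.e. the maximizer of $\Pi[\mathbf{s}(t)]$ over $\mathcal{S}^2$, satisfies the equation $$\frac{\partial H}{\partial s_p}=\frac{\partial H}{\partial s_q}=0,\qquad H:=\Big(\gamma\frac{df}{dt}-s_p(t)-s_q(t)\Big)e^{-\theta t}+\Psi\frac{df}{dt},$$ where $f(t)$ and $\Psi(t)$ are the solutions of the boundary-value problem $$\frac{df}{dt}=(1-f)\Big(p(s_p(t))+q(s_q(t))f\Big),\qquad f(0)=0,$$ $$\frac{d\Psi}{dt}=(\gamma e^{-\theta t}+\Psi)\Big(p(s_p(t))+q(s_q(t))(2f-1)\Big),\qquad \Psi(T)=0.$$ Here in $H$ the derivative $\frac{df}{dt}$ stands for the right-hand side of the first equation.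
   Context: Bass model on the homogeneous complete network with $M$ nodes under the promotion $\mathbf{s}(t)=(s_p(t),s_q(t))$ (spending rates per consumer): all nodes are nonadopters at $t=0$; a nonadopter adopts at rate $p(s_p(t))+\frac{q(s_q(t))}{M-1}N(t)$, where $N(t)$ is the number of adopters and $p$, $q$ are the external and internal influence rates; adopters remain adopters. As $M\to\infty$, the expected fraction of adopters converges (known result) to the solution $f(t)$ of $\frac{df}{dt}=(1-f)\big(p(s_p(t))+q(s_q(t))f\big)$, $f(0)=0$. $T$ is the planning horizon, $\mathcal{S}$ is the set of piecewise-continuous functions from $[0,T]$ to the nonnegative reals, $\theta$ is the discount rate, $\gamma$ is the income generated by the sale of one unit of the product, and the profit is $\Pi[\mathbf{s}(t)]=\int_0^T e^{-\theta t}\big(\gamma\frac{df}{dt}-(s_p(t)+s_q(t))\big)dt$, where $f$ is the expected adoption level.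
   Formalization: Each equation ∂H/∂s_p=0, ∂H/∂s_q=0 is claimed only where that spending rate is positive and both rates are continuous in time (as stated it fails at zero spending, e.g. constant p,q); p,q are assumed nonnegative, continuous on [0,∞), differentiable on (0,∞). *)

(* Defs.v *)
(* Stdlib reals with Coquelicot; MathComp is used only for finite sets of nodes. *)
From Stdlib Require Import Reals List.
From mathcomp Require Import all_boot.
From Coquelicot Require Import Coquelicot.

Set Implicit Arguments.
Unset Strict Implicit.
Unset Printing Implicit Defensive.

Open Scope R_scope.

Definition horizon (T t : R) : Prop := 0 <= t <= T.

(* Continuity at [x] of the restriction of [f] to [D]; values outside [D] are
   irrelevant, so this is one-sided at the endpoints of an interval. *)
Definition continuous_within (D : R -> Prop) (f : R -> R) (x : R) : Prop :=
  filterlim f (within D (locally x)) (locally (f x)).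

(* Finitely many discontinuities, all with finite one-sided limits. *)
Definition piecewise_continuous (T : R) (s : R -> R) : Prop :=
  (exists l : list R,
     forall t, horizon T t -> ~ List.In t l ->
       continuous_within (horizon T) s t) /\
  (forall t, 0 <= t < T -> exists L : R, filterlim s (at_right t) (locally L)) /\
  (forall t, 0 < t <= T -> exists L : R, filterlim s (at_left t) (locally L)).

Definition spending (T : R) (s : R -> R) : Prop :=
  piecewise_continuous T s /\ forall t, horizon T t -> 0 <= s t.

(* The meaning of [dx/dt = dx] when the right-hand side is only piecewise
   continuous: [x] is continuous on the closed interval and differentiable, with
   the prescribed derivative, at all but finitely many times. *)
Definition evolves (T : R) (x dx : R -> R) : Prop :=
  (forall t, horizon T t -> continuous_within (horizon T) x t) /\
  exists l : list R,
    forall t, 0 < t < T -> ~ List.In t l -> is_derive x t (dx t).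

(* Regularity of an influence rate as a function of the spending rate, which
   ranges over the nonnegative reals; the derivative may blow up at 0. *)
Definition influence_rate (r : R -> R) : Prop :=
  (forall x, 0 <= x -> 0 <= r x) /\
  (forall x, 0 <= x -> continuous_within (fun y => 0 <= y) r x) /\
  (forall x, 0 < x -> ex_derive r x).

Definition adoption_rate (p q : R -> R) (M : nat) (sp sq : R -> R)
    (n : nat) (t : R) : R :=
  p (sp t) + q (sq t) / (INR M - 1) * INR n.

(* [P A t] is the probability that the set of adopters at time [t] is exactly
   [A].  The law of the adoption process is given by the forward (master)
   equation of the Markov chain on configurations in which each nonadopter
   [j \notin A] becomes an adopter at rate [adoption_rate ... #|A| t]. *)
Definition bass_law (T : R) (p q : R -> R) (sp sq : R -> R) (M : nat)
    (P : {set 'I_M} -> R -> R) : Prop :=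
  (forall A, P A 0 = if A == set0 then 1 else 0) /\
  (forall A, evolves T (P A) (fun t =>
     \big[Rplus/0]_(j in A)
        (adoption_rate p q M sp sq #|A :\ j| t * P (A :\ j) t)
     - \big[Rplus/0]_(j in ~: A)
        (adoption_rate p q M sp sq #|A| t * P A t))).

Definition expected_fraction (M : nat) (P : {set 'I_M} -> R -> R) (t : R) : R :=
  \big[Rplus/0]_(A : {set 'I_M}) (INR #|A| / INR M * P A t).

(* [f] is the expected adoption level in the limit of infinitely many nodes. *)
Definition adoption_level (T : R) (p q : R -> R) (sp sq : R -> R)
    (f : R -> R) : Prop :=
  exists P : forall M : nat, {set 'I_M} -> R -> R,
    (forall M : nat, (2 <= M)%N -> bass_law T p q sp sq (P M)) /\
    (forall t, horizon T t ->
       is_lim_seq (fun M => expected_fraction (P M) t) (f t)).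

Definition profit (T theta gamma : R) (f sp sq : R -> R) : R :=
  RInt (fun t => exp (- theta * t) * (gamma * Derive f t - (sp t + sq t))) 0 T.

Definition optimal_promotion (T theta gamma : R) (p q : R -> R)
    (sp sq : R -> R) : Prop :=
  spending T sp /\ spending T sq /\
  exists f, adoption_level T p q sp sq f /\
    forall sp' sq' f' : R -> R,
      spending T sp' -> spending T sq' -> adoption_level T p q sp' sq' f' ->
      profit T theta gamma f' sp' sq' <= profit T theta gamma f sp sq.

Definition bass_rhs (p q : R -> R) (f sp sq : R) : R :=
  (1 - f) * (p sp + q sq * f).

Definition costate_rhs (theta gamma : R) (p q : R -> R)
    (t f Psi sp sq : R) : R :=
  (gamma * exp (- theta * t) + Psi) * (p sp + q sq * (2 * f - 1)).

Definition bass_bvp (T theta gamma : R) (p q : R -> R)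
    (sp sq f Psi : R -> R) : Prop :=
  evolves T f (fun t => bass_rhs p q (f t) (sp t) (sq t)) /\
  f 0 = 0 /\
  evolves T Psi
    (fun t => costate_rhs theta gamma p q t (f t) (Psi t) (sp t) (sq t)) /\
  Psi T = 0.

Definition hamiltonian (theta gamma : R) (p q : R -> R)
    (t f Psi sp sq : R) : R :=
  (gamma * bass_rhs p q f sp sq - sp - sq) * exp (- theta * t)
  + Psi * bass_rhs p q f sp sq.

(* Main.v *)
(* Needle variation.  Fix the optimal pair of controls, replace it on a short
   interval [a, b] around a continuity time t0 by constants (vp, vq), and let f1
   be the new adoption level.  Differentiating Psi * (f1 - f) and integrating, the
   costate equation removes the first-order dependence on f1 - f, so the profit
   changes by the integral over [a, b] of the increment of the Hamiltonian, up to
   O((b - a)^2).  Hence (sp t0, sq t0) maximizes the Hamiltonian over nonnegative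
   spendings, and a positive component is an interior maximum.  Only continuity of
   p and q is needed up to that last step, so p' and q' may be discontinuous.

   To know that the perturbed control is admissible, and that adoption levels are
   exactly the solutions of the Bass equation, the mean-field limit is derived
   from the master equation: if X is the fraction of adopters, E[(X - f)^2]
   satisfies a Gronwall inequality with source O(1/M).  The Bass equation itself
   becomes linear after f = w / (1 + w). *)

Require Import Defs.
From HB Require Import structures.
From Stdlib Require Import Reals List Lra.
From mathcomp Require Import all_boot.
From Coquelicot Require Import Coquelicot.

Open Scope R_scope.

Local Arguments INR : simpl never.

(** * Piecewise continuous functions and scalar evolution equations *)

Lemma is_derive_eq (f : R -> R) (x l l' : R) :
  is_derive f x l -> l = l' -> is_derive f x l'.
Proof. by move=> H <-. Qed.

Lemma exp_monotone (x y : R) : x <= y -> exp x <= exp y.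
Proof.
by case=> [h|->]; [apply: Rlt_le; apply: exp_increasing|right].
Qed.

(** Stated as a limit along a product filter, so that one closure argument serves sums, differences
    and products. *)
Definition jointly_continuous (op : R -> R -> R) : Prop :=
  forall a b, filterlim (fun z => op (fst z) (snd z))
    (filter_prod (locally a) (locally b)) (locally (op a b)).

Lemma jointly_continuous_plus : jointly_continuous Rplus.
Proof. by move=> a b; apply: (filterlim_plus (V := R_NormedModule)). Qed.

Lemma jointly_continuous_mult : jointly_continuous Rmult.
Proof. by move=> a b; apply: (filterlim_mult (K := R_AbsRing)). Qed.

Lemma jointly_continuous_minus : jointly_continuous Rminus.
Proof.
move=> a b; apply: (filterlim_comp_2 (H := locally (- b)) _ _ Rplus).
- exact: filterlim_fst.
- apply: filterlim_comp; first exact: filterlim_snd.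
  exact: (filterlim_opp (V := R_NormedModule)).
- exact: (filterlim_plus (V := R_NormedModule)).
Qed.

Lemma continuous_within_op (op : R -> R -> R) (T : R) (f g : R -> R) (x : R) :
  jointly_continuous op ->
  continuous_within (horizon T) f x -> continuous_within (horizon T) g x ->
  continuous_within (horizon T) (fun t => op (f t) (g t)) x.
Proof.
by move=> hop hf hg; apply: (filterlim_comp_2 _ _ op); [exact: hf|exact: hg|exact: hop].
Qed.

Lemma continuous_within_influence (T : R) (r s : R -> R) (t : R) :
  influence_rate r -> spending T s -> horizon T t ->
  continuous_within (horizon T) s t ->
  continuous_within (horizon T) (fun y => r (s y)) t.
Proof.
move=> [_ [hr _]] [_ spos] ht hs P hP.
have := hr (s t) (spos t ht) P hP; rewrite /filtermap /within => h.
have := hs _ h; rewrite /filtermap /within; apply: filter_imp => y h1 hy.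
by apply: h1 => //; apply: spos.
Qed.

Lemma piecewise_continuous_op (op : R -> R -> R) (T : R) (f g : R -> R) :
  jointly_continuous op ->
  piecewise_continuous T f -> piecewise_continuous T g ->
  piecewise_continuous T (fun t => op (f t) (g t)).
Proof.
move=> hop [[lf hf] [fr fl]] [[lg hg] [gr gl]]; split; last split.
- exists (lf ++ lg) => t ht hl; apply: continuous_within_op => //.
  + by apply: hf => // h; apply: hl; apply: in_or_app; left.
  + by apply: hg => // h; apply: hl; apply: in_or_app; right.
- move=> t ht; have [a ha] := fr t ht; have [b hb] := gr t ht.
  by exists (op a b); apply: (filterlim_comp_2 _ _ op); [exact: ha|exact: hb|exact: hop].
- move=> t ht; have [a ha] := fl t ht; have [b hb] := gl t ht.
  by exists (op a b); apply: (filterlim_comp_2 _ _ op); [exact: ha|exact: hb|exact: hop].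
Qed.

Lemma at_right_le_within (T t : R) : 0 <= t < T ->
  filter_le (at_right t) (within (horizon T) (locally t)).
Proof.
move=> ht P; rewrite /at_right /within => hP.
have h : locally t (fun y => y < T) by apply: open_lt; lra.
apply: filter_imp (filter_and _ _ hP h) => y [h1 h2] h3.
by apply: h1; rewrite /horizon; lra.
Qed.

Lemma at_left_le_within (T t : R) : 0 < t <= T ->
  filter_le (at_left t) (within (horizon T) (locally t)).
Proof.
move=> ht P; rewrite /at_left /within => hP.
have h : locally t (fun y => 0 < y) by apply: open_gt; lra.
apply: filter_imp (filter_and _ _ hP h) => y [h1 h2] h3.
by apply: h1; rewrite /horizon; lra.
Qed.

Lemma continuous_within_piecewise (T : R) (f : R -> R) :
  (forall t, horizon T t -> continuous_within (horizon T) f t) ->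
  piecewise_continuous T f.
Proof.
move=> hf; split; last split.
- by exists nil => t ht _; apply: hf.
- move=> t ht; exists (f t).
  by apply: (filterlim_filter_le_1 _ (at_right_le_within T t ht)); apply: hf; rewrite /horizon; lra.
- move=> t ht; exists (f t).
  by apply: (filterlim_filter_le_1 _ (at_left_le_within T t ht)); apply: hf; rewrite /horizon; lra.
Qed.

Lemma continuous_continuous_within (D : R -> Prop) (f : R -> R) (t : R) :
  continuous f t -> continuous_within D f t.
Proof.
by move=> h; apply: (filterlim_filter_le_1 _ _ h); apply: filter_le_within.
Qed.

Lemma continuous_piecewise (T : R) (f : R -> R) :
  (forall t, continuous f t) -> piecewise_continuous T f.
Proof.
by move=> h; apply: continuous_within_piecewise => t _; apply: continuous_continuous_within.
Qed.

Lemma continuous_within_interior (T : R) (f : R -> R) (t : R) : 0 < t < T ->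
  continuous_within (horizon T) f t -> continuous f t.
Proof.
move=> ht h P hP; have := h P hP; rewrite /filtermap /within => h'.
have h0 : locally t (fun y => 0 < y) by apply: open_gt; lra.
have hT : locally t (fun y => y < T) by apply: open_lt; lra.
apply: filter_imp (filter_and _ _ h' (filter_and _ _ h0 hT)) => y [h1 [h2 h3]].
by apply: h1; rewrite /horizon; lra.
Qed.

(** One-sided limits of the spending are nonnegative because the half-line is closed. So they lie
    where [r] is continuous relative to the nonnegative reals. *)
Lemma piecewise_continuous_influence (T : R) (r s : R -> R) :
  influence_rate r -> spending T s -> piecewise_continuous T (fun t => r (s t)).
Proof.
move=> hinf hs; have [_ [hr _]] := hinf; have [[[l hl] [sr sl]] spos] := hs.
have lim (F : (R -> Prop) -> Prop) (L : R) : ProperFilter F ->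
    F (fun t => horizon T t) -> filterlim s F (locally L) ->
    filterlim (fun t => r (s t)) F (locally (r L)).
  move=> FF hF hL.
  have Lpos : 0 <= L.
    apply: (closed_filterlim_loc (F := F) s (fun y => 0 <= y) L hL).
      by apply: filter_imp hF => t; apply: spos.
    exact: closed_ge.
  move=> P hP; have := hr L Lpos P hP; rewrite /filtermap /within => h.
  have h' : F (fun t => 0 <= s t -> P (r (s t))) := hL _ h.
  apply: filter_imp (filter_and _ _ h' hF) => t [h1 h2].
  by apply: h1; apply: spos.
split; last split.
- exists l => t ht hnl; apply: continuous_within_influence => //; exact: hl.
- move=> t ht; have [L hL] := sr t ht; exists (r L).
  apply: lim => //; apply: (at_right_le_within T t ht).
  by rewrite /within; apply: filter_forall.
- move=> t ht; have [L hL] := sl t ht; exists (r L).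
  apply: lim => //; apply: (at_left_le_within T t ht).
  by rewrite /within; apply: filter_forall.
Qed.

(** Induction on the exceptional points, cutting the interval at each one inside it. With none left,
    the one-sided limits extend [g] continuously from the open interval to the closed one. *)
Lemma ex_RInt_piecewise (T : R) (g : R -> R) (a b : R) :
  piecewise_continuous T g -> 0 <= a <= b -> b <= T -> ex_RInt g a b.
Proof.
move=> [[l hl] [gr gl]].
have : forall t, a < t < b -> horizon T t -> ~ In t l -> continuous_within (horizon T) g t.
  by move=> t _; apply: hl.
elim: l a b {hl} => [|c l IH] a b hl hab hbT.
  case: (Req_dec a b) => [->|ne]; first exact: ex_RInt_point.
  have lt : a < b by lra.
  have [|la hla] := gr a; first lra.
  have [|lb hlb] := gl b; first lra.
  have [|h [h1 [h2 _]]] := C0_extension_lt g la lb a b lt _ hla hlb.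
    move=> t ht; apply: (continuous_within_interior T); first lra.
    by apply: hl => //; rewrite /horizon; lra.
  apply: (ex_RInt_ext h).
    by move=> t; rewrite Rmin_left ?Rmax_right; [apply: h2|lra..].
  by apply: ex_RInt_continuous => z _; apply: h1.
have [hc|hc] : (a < c < b) \/ ~ (a < c < b) by lra.
  apply: (ex_RInt_Chasles _ _ c); apply: IH; try lra.
    by move=> t ht1 ht2 hn; apply: hl => //; [lra|move=> [e|//]; lra].
  by move=> t ht1 ht2 hn; apply: hl => //; [lra|move=> [e|//]; lra].
apply: IH => // t ht1 ht2 hn; apply: hl => // -[e|//]; subst; lra.
Qed.

Lemma piecewise_continuous_bounded (T : R) (g : R -> R) : 0 < T ->
  piecewise_continuous T g ->
  exists K, 0 <= K /\ forall t, horizon T t -> Rabs (g t) <= K.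
Proof.
move=> hT hg.
have [|K hK] := @ex_RInt_ub R_NormedModule g 0 T.
  by apply: (ex_RInt_piecewise T) => //; lra.
have {}hK t : horizon T t -> Rabs (g t) <= K.
  by move=> ht; apply: hK; rewrite Rmin_left ?Rmax_right; lra || apply: ht.
exists K; split=> //; apply: Rle_trans (Rabs_pos _) (hK 0 _); rewrite /horizon; lra.
Qed.

Lemma RInt_ext_finite (f g : R -> R) (l : list R) (a b : R) : a <= b ->
  ex_RInt f a b -> (forall t, a < t < b -> ~ In t l -> f t = g t) ->
  is_RInt g a b (RInt f a b).
Proof.
elim: l a b => [|c l IH] a b hab hf h.
  apply: (is_RInt_ext f); last exact: RInt_correct.
  by move=> t; rewrite Rmin_left ?Rmax_right; [move=> ht; apply: h|lra..].
have [hc|hc] : (a < c < b) \/ ~ (a < c < b) by lra.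
  have h1 : ex_RInt f a c by apply: (ex_RInt_Chasles_1 _ _ _ b) => //; lra.
  have h2 : ex_RInt f c b by apply: (ex_RInt_Chasles_2 _ a) => //; lra.
  rewrite -(RInt_Chasles f a c b) //; apply: is_RInt_Chasles; apply: IH => //; try lra.
    by move=> t ht hn; apply: h => //; [lra|move=> [e|//]; lra].
  by move=> t ht hn; apply: h => //; [lra|move=> [e|//]; lra].
by apply: IH => // t ht hn; apply: h => // -[e|//]; subst; lra.
Qed.

(** A bound on [g] makes the primitive Lipschitz, hence continuous up to the endpoints. It is
    differentiable wherever [g] is continuous. *)
Lemma evolves_primitive (T : R) (g : R -> R) : 0 < T ->
  piecewise_continuous T g -> evolves T (fun t => RInt g 0 t) g.
Proof.
move=> hT hg; have [K [K0 hK]] := piecewise_continuous_bounded T g hT hg.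
split.
  move=> t ht; apply/filterlim_locally => eps.
  (* The divisor is [K + 1] because the bound [K] may be zero. *)
  have heps : 0 < eps / (K + 1) by apply: Rdiv_lt_0_compat; [exact: cond_pos|lra].
  exists (mkposreal _ heps) => y hy hyT.
  have main u v : 0 <= u <= v -> v <= T -> v - u < eps / (K + 1) ->
      Rabs (RInt g 0 v - RInt g 0 u) < eps.
    move=> huv hv hd.
    have -> : RInt g 0 v - RInt g 0 u = RInt g u v.
      rewrite -(RInt_Chasles g 0 u v); try by apply: (ex_RInt_piecewise T) => //; lra.
      by rewrite /plus /=; lra.
    apply: (Rle_lt_trans _ ((v - u) * K)).
      apply: abs_RInt_le_const; first lra.
        by apply: (ex_RInt_piecewise T) => //; lra.
      by move=> z hz; apply: hK; rewrite /horizon; lra.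
    apply: (Rle_lt_trans _ ((v - u) * (K + 1))).
      by apply: Rmult_le_compat_l; lra.
    apply: (Rlt_le_trans _ (eps / (K + 1) * (K + 1))); last by right; field; lra.
    by apply: Rmult_lt_compat_r; lra.
  have {}hy : Rabs (y - t) < eps / (K + 1) := hy.
  have hy' := Rabs_def2 _ _ hy.
  change (Rabs (RInt g 0 y - RInt g 0 t) < eps).
  rewrite /horizon in ht hyT.
  case: (Rle_dec t y) => hty; first by apply: main; lra.
  by rewrite Rabs_minus_sym; apply: main; lra.
case: (hg) => -[l hl] _; exists l => t ht hn.
have ct : continuous g t.
  by apply: (continuous_within_interior T) => //; apply: hl => //; rewrite /horizon; lra.
apply: (is_derive_RInt _ _ 0) => //.
have h0 : locally t (fun y => 0 < y) by apply: open_gt; lra.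
have h1 : locally t (fun y => y < T) by apply: open_lt; lra.
apply: filter_imp (filter_and _ _ h0 h1) => y hy.
by apply: RInt_correct; apply: (ex_RInt_piecewise T) => //; lra.
Qed.

(** * Calculus, comparison and linear equations for [evolves] *)

Lemma evolves_piecewise (T : R) (x dx : R -> R) :
  evolves T x dx -> piecewise_continuous T x.
Proof. by move=> [h _]; apply: continuous_within_piecewise. Qed.

Lemma evolves_op (op : R -> R -> R) (dop : R -> R -> R -> R -> R)
    (T : R) (x y dx dy : R -> R) :
  jointly_continuous op ->
  (forall t, is_derive x t (dx t) -> is_derive y t (dy t) ->
     is_derive (fun t => op (x t) (y t)) t (dop (x t) (y t) (dx t) (dy t))) ->
  evolves T x dx -> evolves T y dy ->
  evolves T (fun t => op (x t) (y t)) (fun t => dop (x t) (y t) (dx t) (dy t)).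
Proof.
move=> hop hd [cx [lx ex]] [cy [ly ey]]; split.
  by move=> t ht; apply: continuous_within_op => //; [exact: cx|exact: cy].
exists (lx ++ ly) => t ht hn; apply: hd.
  by apply: ex => // h; apply: hn; apply: in_or_app; left.
by apply: ey => // h; apply: hn; apply: in_or_app; right.
Qed.

Lemma evolves_plus (T : R) (x y dx dy : R -> R) :
  evolves T x dx -> evolves T y dy ->
  evolves T (fun t => x t + y t) (fun t => dx t + dy t).
Proof.
apply: (evolves_op Rplus (fun _ _ a b => a + b)); first exact: jointly_continuous_plus.
by move=> t; apply: (is_derive_plus (V := R_NormedModule)).
Qed.

Lemma evolves_minus (T : R) (x y dx dy : R -> R) :
  evolves T x dx -> evolves T y dy ->
  evolves T (fun t => x t - y t) (fun t => dx t - dy t).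
Proof.
apply: (evolves_op Rminus (fun _ _ a b => a - b)); first exact: jointly_continuous_minus.
by move=> t; apply: (is_derive_minus (V := R_NormedModule)).
Qed.

Lemma evolves_mult (T : R) (x y dx dy : R -> R) :
  evolves T x dx -> evolves T y dy ->
  evolves T (fun t => x t * y t) (fun t => dx t * y t + x t * dy t).
Proof.
apply: (evolves_op Rmult (fun x y a b => a * y + x * b)); first exact: jointly_continuous_mult.
by move=> t hx hy; apply: (is_derive_mult (K := R_AbsRing)) => //; apply: Rmult_comm.
Qed.

Lemma evolves_smooth (T : R) (x dx : R -> R) :
  (forall t, is_derive x t (dx t)) -> evolves T x dx.
Proof.
move=> h; split.
  move=> t _; apply: continuous_continuous_within.
  by apply: (ex_derive_continuous (V := R_NormedModule)); exists (dx t).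
by exists nil => t _ _.
Qed.

Lemma evolves_const (T c : R) : evolves T (fun _ => c) (fun _ => 0).
Proof. by apply: evolves_smooth => t; apply: (is_derive_const (V := R_NormedModule)). Qed.

Lemma evolves_comp (T : R) (phi dphi x dx : R -> R) :
  (forall t, horizon T t -> is_derive phi (x t) (dphi (x t))) -> evolves T x dx ->
  evolves T (fun t => phi (x t)) (fun t => dphi (x t) * dx t).
Proof.
move=> hphi [cx [l hl]]; split.
  move=> t ht; apply: (filterlim_comp _ _ _ x phi); first exact: cx.
  by apply: (ex_derive_continuous (V := R_NormedModule)); exists (dphi (x t)); apply: hphi.
exists l => t ht hn; apply: is_derive_eq.
  apply: (is_derive_comp (V := R_NormedModule) phi x); first by apply: hphi; rewrite /horizon; lra.
  exact: hl.
by rewrite /scal /= /mult /=; lra.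
Qed.

Lemma evolves_ext (T : R) (x x' dx dx' : R -> R) :
  (forall t, horizon T t -> x t = x' t) -> (forall t, 0 < t < T -> dx t = dx' t) ->
  evolves T x dx -> evolves T x' dx'.
Proof.
move=> hx hdx [cx [l hl]]; split.
  move=> t ht; rewrite /continuous_within -hx //.
  by apply: (filterlim_within_ext _ x) => //; apply: cx.
exists l => t ht hn; rewrite -hdx //.
apply: (is_derive_ext_loc x); last exact: hl.
have h0 : locally t (fun y => 0 < y) by apply: open_gt; lra.
have h1 : locally t (fun y => y < T) by apply: open_lt; lra.
by apply: filter_imp (filter_and _ _ h0 h1) => y hy; apply: hx; rewrite /horizon; lra.
Qed.

(** The mean value theorem holds between consecutive exceptional times, and the resulting bounds add
    up because [x] is continuous across them. *)
Lemma evolves_mean_ge (T : R) (x dx : R -> R) (m a b : R) :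
  evolves T x dx -> 0 <= a <= b -> b <= T ->
  (forall t, a < t < b -> m <= dx t) -> m * (b - a) <= x b - x a.
Proof.
move=> [cx [l hl]] hab hbT hm.
have : forall t, a < t < b -> ~ In t l -> is_derive x t (dx t).
  by move=> t ht; apply: hl; lra.
elim: l a b hab hbT hm {hl} => [|c l IH] a b hab hbT hm hl.
  case: (Req_dec a b) => [->|ne]; first lra.
  (* Clamping makes the one-sided continuity at the endpoints two-sided. *)
  pose cl t := Rmax a (Rmin b t).
  have cl_id t : a <= t <= b -> cl t = t.
    by move=> ht; rewrite /cl Rmin_right ?Rmax_right; lra.
  have cl_in t : a <= cl t <= b.
    by rewrite /cl; split; [exact: Rmax_l|apply: Rmax_lub; [lra|exact: Rmin_l]].
  have cl_lip t u : Rabs (cl u - cl t) <= Rabs (u - t).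
    rewrite /cl /Rmin; case: (Rle_dec b t) => ?; case: (Rle_dec b u) => ?;
      rewrite /Rmax; repeat case: Rle_dec => ?; split_Rabs; lra.
  have emin : Rmin a b = a by apply: Rmin_left; lra.
  have emax : Rmax a b = b by apply: Rmax_right; lra.
  (* The intermediate point may be an endpoint, where [m <= dx] is not assumed. [Rmax m (dx t)]
     equals [dx t] inside the interval and is at least [m] everywhere. *)
  have [|t|c [hc e]] := MVT_gen (fun t => x (cl t)) a b (fun t => Rmax m (dx t));
      rewrite ?emin ?emax.
  - move=> t ht.
    rewrite Rmax_right; last exact: hm.
    apply: (is_derive_ext_loc x); last by apply: hl.
    have h0 : locally t (fun y => a < y) by apply: open_gt; lra.
    have h1 : locally t (fun y => y < b) by apply: open_lt; lra.
    by apply: filter_imp (filter_and _ _ h0 h1) => y hy; rewrite cl_id //; lra.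
  - move=> ht; apply/continuity_pt_filterlim.
    move=> P hP; have hc : horizon T (cl t) by have := cl_in t; rewrite /horizon; lra.
    have := cx _ hc P hP; rewrite /filtermap /within => -[eps heps].
    exists eps => y hy; apply: heps; last by have := cl_in y; rewrite /horizon; lra.
    exact: Rle_lt_trans (cl_lip _ _) hy.
  - rewrite !cl_id in e; try lra.
    by rewrite e; apply: Rmult_le_compat_r; [lra|exact: Rmax_l].
have [hc|hc] : (a < c < b) \/ ~ (a < c < b) by lra.
  have h1 : m * (c - a) <= x c - x a.
    apply: IH => //; try lra; first by move=> t ht; apply: hm; lra.
    by move=> t ht hn; apply: hl => //; [lra|move=> [e|//]; lra].
  have h2 : m * (b - c) <= x b - x c.
    apply: IH => //; try lra; first by move=> t ht; apply: hm; lra.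
    by move=> t ht hn; apply: hl => //; [lra|move=> [e|//]; lra].
  lra.
by apply: IH => // t ht hn; apply: hl => // -[e|//]; subst; lra.
Qed.

Lemma evolves_mean_le (T : R) (x dx : R -> R) (m a b : R) :
  evolves T x dx -> 0 <= a <= b -> b <= T ->
  (forall t, a < t < b -> dx t <= m) -> x b - x a <= m * (b - a).
Proof.
move=> hx hab hbT hm.
have := evolves_mean_ge T _ _ (- m) a b (evolves_minus T _ _ _ _ (evolves_const T 0) hx) hab hbT.
move=> h; suff : - m * (b - a) <= 0 - x b - (0 - x a) by lra.
by apply: h => t ht; have := hm t ht; lra.
Qed.

(** Multiplying by [exp (- K * (t - a))], which is at most 1, leaves a function whose derivative is
    at most [c]. *)
Lemma evolves_gronwall (T : R) (x dx : R -> R) (K c a b : R) :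
  evolves T x dx -> 0 <= a <= b -> b <= T -> 0 <= K -> 0 <= c ->
  (forall t, a < t < b -> dx t <= K * x t + c) ->
  x b <= exp (K * (b - a)) * (x a + c * (b - a)).
Proof.
move=> hx hab hbT hK hc h.
have hE : evolves T (fun t => exp (- K * (t - a))) (fun t => - K * exp (- K * (t - a))).
  by apply: evolves_smooth => t; auto_derive => //; rewrite /Rminus; ring.
have hy := evolves_mult T _ _ _ _ hE hx.
have := evolves_mean_le T _ _ c a b hy hab hbT.
have -> : - K * (a - a) = 0 by ring.
rewrite exp_0 => {}h1.
have {}h1 : exp (- K * (b - a)) * x b - 1 * x a <= c * (b - a).
  apply: h1 => t ht.
  have e1 : exp (- K * (t - a)) <= 1 by rewrite -exp_0; apply: exp_monotone; nra.
  have e0 := exp_pos (- K * (t - a)).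
  have := h t ht; nra.
have e : exp (K * (b - a)) * exp (- K * (b - a)) = 1.
  by rewrite -exp_plus -exp_0; congr exp; ring.
have -> : x b = exp (K * (b - a)) * (exp (- K * (b - a)) * x b) by rewrite -Rmult_assoc e; ring.
by apply: Rmult_le_compat_l; [apply: Rlt_le; apply: exp_pos|lra].
Qed.

Lemma evolves_exp (T : R) (x dx : R -> R) :
  evolves T x dx -> evolves T (fun t => exp (x t)) (fun t => exp (x t) * dx t).
Proof. by apply: (evolves_comp T exp exp) => t _; apply: is_derive_exp. Qed.

(** Variation of constants for [y' = b - a * y] with [y 0 = y0]. *)
Definition linear_solution (a b : R -> R) (y0 t : R) : R :=
  exp (- RInt a 0 t) * (y0 + RInt (fun s => exp (RInt a 0 s) * b s) 0 t).

Lemma linear_solution_0 (a b : R -> R) (y0 : R) : linear_solution a b y0 0 = y0.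
Proof.
rewrite /linear_solution !RInt_point /zero /= Ropp_0 exp_0; ring.
Qed.

Lemma evolves_linear (T : R) (a b : R -> R) (y0 : R) : 0 < T ->
  piecewise_continuous T a -> piecewise_continuous T b ->
  evolves T (linear_solution a b y0)
    (fun t => b t - a t * linear_solution a b y0 t).
Proof.
move=> hT ha hb.
have hA := evolves_primitive T a hT ha.
have hA' := evolves_minus T _ _ _ _ (evolves_const T 0) hA.
have hg : piecewise_continuous T (fun s => exp (RInt a 0 s) * b s).
  apply: piecewise_continuous_op => //; first exact: jointly_continuous_mult.
  exact: evolves_piecewise (evolves_exp T _ _ hA).
have hB := evolves_plus T _ _ _ _ (evolves_const T y0) (evolves_primitive T _ hT hg).
have := evolves_mult T _ _ _ _ (evolves_exp T _ _ hA') hB.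
apply: evolves_ext => t ht; rewrite /linear_solution; first by rewrite /Rminus Rplus_0_l.
have -> : 0 - RInt a 0 t = - RInt a 0 t by ring.
have e : exp (- RInt a 0 t) * exp (RInt a 0 t) = 1.
  by rewrite -exp_plus -exp_0; congr exp; ring.
set E := exp (RInt a 0 t) in e *; set E' := exp (- _) in e *; set B := RInt _ _ _.
have -> : E' * (0 + E * b t) = b t by rewrite Rplus_0_l -Rmult_assoc e; ring.
ring.
Qed.

(** The integrating factor [exp (RInt a 0 t)] turns the differential inequality into monotonicity of
    the product. *)
Lemma evolves_nonneg (T : R) (x dx a : R -> R) : 0 < T ->
  piecewise_continuous T a -> evolves T x dx -> 0 <= x 0 ->
  (forall t, 0 < t < T -> - (a t * x t) <= dx t) ->
  forall t, horizon T t -> 0 <= x t.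
Proof.
move=> hT ha hx x0 h t ht.
have hA := evolves_primitive T a hT ha.
have hy := evolves_mult T _ _ _ _ (evolves_exp T _ _ hA) hx.
have e0 := exp_pos (RInt a 0 t).
have := evolves_mean_ge T _ _ 0 0 t hy; rewrite RInt_point /zero /= exp_0.
rewrite /horizon in ht.
move=> h1; have {}h1 : 0 * (t - 0) <= exp (RInt a 0 t) * x t - 1 * x 0.
  apply: h1; try lra; move=> s hs.
  have := h s; have := exp_pos (RInt a 0 s); nra.
apply: (Rmult_le_reg_l (exp (RInt a 0 t))) => //; lra.
Qed.

(** * The mean-field limit *)

(** These instances open the generic big-operator lemmas (exchange, reindexing, distributivity) to
    finite sums of reals. *)
HB.instance Definition _ := Monoid.isComLaw.Build R 0 Rplus
  (fun x y z => esym (Rplus_assoc x y z)) Rplus_comm Rplus_0_l.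
HB.instance Definition _ := Monoid.isMulLaw.Build R 0 Rmult Rmult_0_l Rmult_0_r.
HB.instance Definition _ := Monoid.isAddLaw.Build R Rmult Rplus
  (fun x y z => Rmult_plus_distr_r x y z) (fun x y z => Rmult_plus_distr_l x y z).

Lemma sum_const (I : finType) (A : {set I}) (c : R) :
  \big[Rplus/0]_(j in A) c = INR #|A| * c.
Proof.
rewrite big_const; elim: #|A| => [|n IH]; first by rewrite /= Rmult_0_l.
by rewrite iterS IH S_INR; ring.
Qed.

Lemma sum_minus (I : Type) (r : seq I) (S : pred I) (F G : I -> R) :
  \big[Rplus/0]_(i <- r | S i) (F i - G i) =
  \big[Rplus/0]_(i <- r | S i) F i - \big[Rplus/0]_(i <- r | S i) G i.
Proof.
by elim/big_rec3: _ => [|i x y z _ ->]; ring.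
Qed.

Lemma sum_nonneg (I : Type) (r : seq I) (S : pred I) (F : I -> R) :
  (forall i, S i -> 0 <= F i) -> 0 <= \big[Rplus/0]_(i <- r | S i) F i.
Proof.
by move=> h; elim/big_ind: _ => //; [lra|move=> x y; lra].
Qed.

Lemma sum_le (I : Type) (r : seq I) (S : pred I) (F G : I -> R) :
  (forall i, S i -> F i <= G i) ->
  \big[Rplus/0]_(i <- r | S i) F i <= \big[Rplus/0]_(i <- r | S i) G i.
Proof.
by move=> h; elim/big_ind2: _ => //; [lra|move=> x y z t; lra].
Qed.

Lemma evolves_sum (T : R) (I : Type) (r : seq I) (x dx : I -> R -> R) :
  (forall i, evolves T (x i) (dx i)) ->
  evolves T (fun t => \big[Rplus/0]_(i <- r) x i t)
    (fun t => \big[Rplus/0]_(i <- r) dx i t).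
Proof.
move=> h; elim: r => [|i r IH].
  by apply: evolves_ext (evolves_const T 0) => t _; rewrite big_nil.
by apply: evolves_ext (evolves_plus T _ _ _ _ (h i) IH) => t _; rewrite big_cons.
Qed.

(* The master equation tested against a function of the number of adopters gives
   the generator of the pure birth process counting the adopters. *)
Lemma master_equation_dual (M : nat) (phi r : nat -> R) (w : {set 'I_M} -> R) :
  \big[Rplus/0]_(A : {set 'I_M})
    (phi #|A| * (\big[Rplus/0]_(j in A) (r #|A :\ j| * w (A :\ j))
                 - \big[Rplus/0]_(j in ~: A) (r #|A| * w A))) =
  \big[Rplus/0]_(A : {set 'I_M})
    (INR (M - #|A|) * r #|A| * (phi #|A|.+1 - phi #|A|) * w A).
Proof.
have inflow : \big[Rplus/0]_(A : {set 'I_M})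
      (phi #|A| * \big[Rplus/0]_(j in A) (r #|A :\ j| * w (A :\ j))) =
    \big[Rplus/0]_(A : {set 'I_M}) \big[Rplus/0]_(j in ~: A)
      (phi #|A|.+1 * (r #|A| * w A)).
  under eq_bigr => A _ do rewrite big_distrr.
  (* For a fixed node [j], removing [j] is a bijection from the sets containing it to the sets
     avoiding it. It turns inflow into [A] into outflow from [A :\ j]. *)
  rewrite (exchange_big_dep xpredT) //= [RHS](exchange_big_dep xpredT) //=.
  apply: eq_bigr => j _.
  rewrite (reindex_onto (fun B => j |: B) (fun A => A :\ j)) /=; last first.
    by move=> A hA; rewrite setD1K.
  apply: eq_big => [B|B].
    rewrite setU11 /= inE; apply/eqP/idP => [<-|hB]; first by rewrite !inE eqxx.
    by rewrite setU1K.
  rewrite setU11 /= => /eqP e.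
  have hB : j \notin B by rewrite -e !inE eqxx.
  by rewrite e cardsU1 hB.
under eq_bigr => A _ do rewrite Rmult_minus_distr_l.
rewrite sum_minus inflow -sum_minus; apply: eq_bigr => A _.
by rewrite !sum_const cardsCs setCK card_ord; ring.
Qed.

(** * Probability laws of the adoption process and their concentration *)

Lemma INR_ge_2 (M : nat) : (2 <= M)%N -> 2 <= INR M.
Proof. by move=> /leP h; have := le_INR _ _ h; rewrite !S_INR; change (INR 0) with 0; lra. Qed.

Lemma adoption_rate_piecewise (T : R) (p q sp sq : R -> R) (M n : nat) :
  influence_rate p -> influence_rate q -> spending T sp -> spending T sq ->
  piecewise_continuous T (adoption_rate p q M sp sq n).
Proof.
move=> hp hq hsp hsq; rewrite /adoption_rate.
have cst c : piecewise_continuous T (fun _ => c).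
  by apply: continuous_piecewise => t; apply: continuous_const.
apply: (piecewise_continuous_op Rplus); first exact: jointly_continuous_plus.
  exact: piecewise_continuous_influence.
apply: (piecewise_continuous_op Rmult) (cst _); first exact: jointly_continuous_mult.
apply: (piecewise_continuous_op Rmult) (cst _); first exact: jointly_continuous_mult.
exact: piecewise_continuous_influence.
Qed.

Lemma adoption_rate_nonneg (T : R) (p q sp sq : R -> R) (M n : nat) (t : R) :
  influence_rate p -> influence_rate q -> spending T sp -> spending T sq ->
  (2 <= M)%N -> horizon T t -> 0 <= adoption_rate p q M sp sq n t.
Proof.
move=> [hp _] [hq _] [_ hsp] [_ hsq] /INR_ge_2 hM ht; rewrite /adoption_rate.
have h1 := hp _ (hsp t ht); have h2 := hq _ (hsq t ht).
have : 0 <= q (sq t) / (INR M - 1) by apply: Rdiv_le_0_compat; lra.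
have := pos_INR n; nra.
Qed.

(** Induction on the number of adopters: the inflow comes from configurations with one adopter
    fewer, and the outflow is a multiple of [P A] itself. *)
Lemma bass_law_nonneg (T : R) (p q sp sq : R -> R) (M : nat)
    (P : {set 'I_M} -> R -> R) : 0 < T ->
  influence_rate p -> influence_rate q -> spending T sp -> spending T sq ->
  (2 <= M)%N -> bass_law T p q sp sq P ->
  forall A t, horizon T t -> 0 <= P A t.
Proof.
move=> hT hp hq hsp hsq hM [P0 hP] A.
have [n] := ubnP #|A|; elim: n A => [//|n IH] A hA t ht.
apply: (evolves_nonneg T (P A) _
  (fun t => INR #|~: A| * adoption_rate p q M sp sq #|A| t) hT _ (hP A)) => //.
- apply: (piecewise_continuous_op Rmult); first exact: jointly_continuous_mult.
    by apply: continuous_piecewise => s; apply: continuous_const.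
  exact: adoption_rate_piecewise.
- by rewrite P0; case: ifP => _; lra.
- move=> s hs; rewrite sum_const.
  have hs' : horizon T s by rewrite /horizon; lra.
  have : 0 <= \big[Rplus/0]_(j in A)
     (adoption_rate p q M sp sq #|A :\ j| s * P (A :\ j) s).
    apply: sum_nonneg => j hj; apply: Rmult_le_pos.
      exact: (adoption_rate_nonneg T).
    apply: IH => //; move: hA; rewrite (cardsD1 j A) hj add1n ltnS; exact.
  by lra.
Qed.

(** Testing the master equation against the constant 1 shows that the total mass has zero
    derivative. *)
Lemma bass_law_total (T : R) (p q sp sq : R -> R) (M : nat)
    (P : {set 'I_M} -> R -> R) : bass_law T p q sp sq P ->
  forall t, horizon T t -> \big[Rplus/0]_(A : {set 'I_M}) P A t = 1.
Proof.
move=> [P0 hP] t ht.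
have h := evolves_sum T _ (index_enum _) _ _ hP.
have d0 s : \big[Rplus/0]_(A : {set 'I_M})
    (\big[Rplus/0]_(j in A) (adoption_rate p q M sp sq #|A :\ j| s * P (A :\ j) s)
     - \big[Rplus/0]_(j in ~: A) (adoption_rate p q M sp sq #|A| s * P A s)) = 0.
  have := master_equation_dual M (fun _ => 1)
    (fun n => adoption_rate p q M sp sq n s) (fun A => P A s).
  under eq_bigr => A _ do rewrite Rmult_1_l.
  by move=> ->; apply: big1 => A _; ring.
rewrite /horizon in ht.
have h1 := evolves_mean_ge T _ _ 0 0 t h; have h2 := evolves_mean_le T _ _ 0 0 t h.
have {}h1 := h1 (conj (Rle_refl 0) (proj1 ht)) (proj2 ht) (fun s _ => Req_le_sym _ _ (d0 s)).
have {}h2 := h2 (conj (Rle_refl 0) (proj1 ht)) (proj2 ht) (fun s _ => Req_le _ _ (d0 s)).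
have e0 : \big[Rplus/0]_(A : {set 'I_M}) P A 0 = 1.
  rewrite (bigD1 set0) //= P0 eqxx big1; first by rewrite /=; lra.
  by move=> A hA; rewrite P0 (negbTE hA).
by move: h1 h2; rewrite /= e0; lra.
Qed.

(** With [x] the fraction of adopters among [m] nodes, the left side is the generator applied to
    [(x - f)^2], corrected by the motion of [f]. The factor [x + x / (m - 1)] is [m * x / (m - 1)],
    and [1 / m] is the second-order effect of a single jump. *)
Lemma drift_bound (x f p q K F m : R) :
  0 <= x <= 1 -> Rabs f <= F -> 0 <= p <= K -> 0 <= q <= K -> 2 <= m ->
  (1 - x) * (p + q * (x + x / (m - 1))) * (2 * (x - f) + 1 / m)
    - 2 * (x - f) * ((1 - f) * (p + q * f))
  <= 2 * K * (1 + F) * ((x - f) * (x - f)) + K * (5 + 2 * F) / (m - 1).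
Proof.
move=> hx /Rabs_le_between hf hp hq hm.
have e0 : 0 < / (m - 1) by apply: Rinv_0_lt_compat; lra.
have e1 : / (m - 1) <= 1 by rewrite -Rinv_1; apply: Rinv_le_contravar; lra.
have g0 : 0 < / m by apply: Rinv_0_lt_compat; lra.
have ge : / m <= / (m - 1) by apply: Rinv_le_contravar; lra.
rewrite /Rdiv Rmult_1_l; move: (/ (m - 1)) (/ m) e0 e1 g0 ge => e g e0 e1 g0 ge.
(* Three contributions: the difference of the limiting drifts, which is divisible by [x - f]; the
   finite-size excess of the internal influence; and the squared jump size. *)
have -> : (1 - x) * (p + q * (x + x * e)) * (2 * (x - f) + g)
    - 2 * (x - f) * ((1 - f) * (p + q * f)) =
  2 * ((x - f) * (x - f) * (q - p - q * (x + f)))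
  + 2 * ((x - f) * ((1 - x) * x * q * e)) + (1 - x) * (p + q * x + q * x * e) * g by ring.
have s1 : q - p - q * (x + f) <= K * (1 + F).
  have : q * (1 + F) <= K * (1 + F) by apply: Rmult_le_compat_r; lra.
  nra.
have {}s1 := Rmult_le_compat_l _ _ _ (Rle_0_sqr (x - f)) s1; rewrite /Rsqr in s1.
have xx : 0 <= (1 - x) * x <= 1 by nra.
have xq : 0 <= (1 - x) * x * q <= K.
  by split; [apply: Rmult_le_pos; lra|apply: Rle_trans (proj2 hq); nra].
have xqe : 0 <= (1 - x) * x * q * e <= K * e.
  by split; [apply: Rmult_le_pos; lra|apply: Rmult_le_compat_r; lra].
have s2 : (x - f) * ((1 - x) * x * q * e) <= (1 + F) * (K * e).
  apply: (Rle_trans _ ((1 + F) * ((1 - x) * x * q * e))).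
    by apply: Rmult_le_compat_r; lra.
  by apply: Rmult_le_compat_l; lra.
have qx : 0 <= q * x <= K by nra.
have qxe : 0 <= q * x * e <= K by split; nra.
have s3 : (1 - x) * (p + q * x + q * x * e) * g <= 3 * K * e.
  apply: Rmult_le_compat; try lra; nra.
lra.
Qed.

(** Gronwall bounds the mean square deviation of the random fraction from [f], and the square of the
    mean deviation is no larger. *)
Lemma expected_fraction_error (T K F : R) (p q sp sq f : R -> R) (M : nat)
    (P : {set 'I_M} -> R -> R) : 0 < T ->
  influence_rate p -> influence_rate q -> spending T sp -> spending T sq ->
  (2 <= M)%N -> bass_law T p q sp sq P ->
  evolves T f (fun t => bass_rhs p q (f t) (sp t) (sq t)) -> f 0 = 0 ->
  (forall t, horizon T t -> Rabs (f t) <= F) ->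
  (forall t, horizon T t -> p (sp t) <= K) ->
  (forall t, horizon T t -> q (sq t) <= K) ->
  forall t, horizon T t ->
  (expected_fraction P t - f t) * (expected_fraction P t - f t) <=
  exp (2 * K * (1 + F) * T) * (K * (5 + 2 * F) * T) / (INR M - 1).
Proof.
move=> hT hp hq hsp hsq hM hbass hf f0 hF hKp hKq t ht.
have m2 := INR_ge_2 M hM.
have Ppos := bass_law_nonneg T p q sp sq M P hT hp hq hsp hsq hM hbass.
have P1 := bass_law_total T p q sp sq M P hbass.
have hp0 s : horizon T s -> 0 <= p (sp s) by move=> hs; apply: hp.1; apply: hsp.2.
have hq0 s : horizon T s -> 0 <= q (sq s) by move=> hs; apply: hq.1; apply: hsq.2.
have h0T : horizon T 0 by rewrite /horizon; lra.
have K0 : 0 <= K by have := hp0 0 h0T; have := hKp 0 h0T; lra.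
have F0 : 0 <= F by have := Rabs_pos (f 0); have := hF 0 h0T; lra.
set X := fun A : {set 'I_M} => INR #|A| / INR M.
have Xin A : 0 <= X A <= 1.
  have h : (#|A| <= M)%N by rewrite -[X in (_ <= X)%N]card_ord max_card.
  move/leP: h => /le_INR h; have := pos_INR #|A| => h'.
  by split; [apply: Rdiv_le_0_compat; lra|apply/Rle_div_l; lra].
pose V s := \big[Rplus/0]_(A : {set 'I_M}) ((X A - f s) * (X A - f s) * P A s).
have dev A : evolves T (fun s => X A - f s)
    (fun s => 0 - bass_rhs p q (f s) (sp s) (sq s)).
  exact: evolves_minus (evolves_const T (X A)) hf.
have dV := evolves_sum T _ (index_enum _) _ _ (fun A =>
  evolves_mult T _ _ _ _ (evolves_mult T _ _ _ _ (dev A) (dev A)) (hbass.2 A)).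
have tT : 0 <= t <= T := ht.
have c0 : 0 <= K * (5 + 2 * F) / (INR M - 1).
  by apply: Rdiv_le_0_compat; [apply: Rmult_le_pos; lra|lra].
have c1 : 0 <= 2 * K * (1 + F) by apply: Rmult_le_pos; lra.
have := evolves_gronwall T _ _ (2 * K * (1 + F)) (K * (5 + 2 * F) / (INR M - 1)) 0 t dV.
move=> /(_ (conj (Rle_refl 0) tT.1) tT.2 c1 c0) gr.
have {gr} : V t <= exp (2 * K * (1 + F) * (t - 0)) *
    (V 0 + K * (5 + 2 * F) / (INR M - 1) * (t - 0)).
  apply: gr => s hs; have hs' : horizon T s by rewrite /horizon; lra.
  rewrite big_split /=.
  rewrite (master_equation_dual M
    (fun n => (INR n / INR M - f s) * (INR n / INR M - f s))
    (fun n => adoption_rate p q M sp sq n s) (fun A => P A s)).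
  (* Since the total mass is 1, the constant source can be spread over the configurations; the bound
     is then checked configuration by configuration. *)
  have eC c : c = \big[Rplus/0]_(A : {set 'I_M}) (c * P A s).
    by rewrite -big_distrr /= P1 // Rmult_1_r.
  rewrite [X in _ <= _ + X]eC -big_split /= [X in _ <= X + _]big_distrr /= -big_split /=.
  apply: sum_le => A _.
  rewrite -!Rmult_assoc -!Rmult_plus_distr_r; apply: Rmult_le_compat_r; first exact: Ppos.
  have hA : (#|A| <= M)%N by rewrite -[X in (_ <= X)%N]card_ord max_card.
  rewrite minus_INR; last exact/leP.
  have := drift_bound (X A) (f s) (p (sp s)) (q (sq s)) K F (INR M) (Xin A) (hF s hs')
    (conj (hp0 s hs') (hKp s hs')) (conj (hq0 s hs') (hKq s hs')) m2.
  rewrite /bass_rhs /adoption_rate S_INR.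
  have -> : INR #|A| = X A * INR M by rewrite /X; field; lra.
  set L := (X in X <= _); set U := (X in _ <= X) => hd.
  by apply: Rle_trans (Req_le _ _ _) (Rle_trans _ _ _ hd (Req_le _ _ _)); rewrite /L /U; field; lra.
have -> : V 0 = 0.
  rewrite /V big1 // => A _; rewrite f0 hbass.1.
  case: eqP => [->|_]; last by ring.
  by rewrite /X cards0 /Rdiv; change (INR 0) with 0; ring.
rewrite Rplus_0_l Rminus_0_r => hV.
have dE : expected_fraction P t - f t =
    \big[Rplus/0]_(A : {set 'I_M}) ((X A - f t) * P A t).
  under [RHS]eq_bigr => A _ do rewrite Rmult_minus_distr_r.
  by rewrite sum_minus -big_distrr /= P1 // Rmult_1_r.
set d := expected_fraction P t - f t in dE *.
(* Nonnegativity of the variance, from the mean of [(X A - f t - d)^2]. *)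
have {dE} dV' : d * d <= V t.
  have -> : d * d = 2 * d * d - d * d * 1 by ring.
  rewrite {2}dE -(P1 t ht) !big_distrr /= -sum_minus; apply: sum_le => A _.
  have -> : 2 * d * ((X A - f t) * P A t) - d * d * P A t =
    (2 * d * (X A - f t) - d * d) * P A t by ring.
  apply: Rmult_le_compat_r; first exact: Ppos.
  by have := Rle_0_sqr (X A - f t - d); rewrite /Rsqr; lra.
apply: Rle_trans dV' (Rle_trans _ _ _ hV _).
have -> : exp (2 * K * (1 + F) * T) * (K * (5 + 2 * F) * T) / (INR M - 1) =
  exp (2 * K * (1 + F) * T) * (K * (5 + 2 * F) / (INR M - 1) * T) by field; lra.
apply: Rmult_le_compat.
- exact: Rlt_le (exp_pos _).
- by apply: Rmult_le_pos; lra.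
- by apply: exp_monotone; apply: Rmult_le_compat_l; lra.
- by apply: Rmult_le_compat_l; lra.
Qed.

Lemma mean_field_limit (T : R) (p q sp sq f : R -> R)
    (P : forall M : nat, {set 'I_M} -> R -> R) : 0 < T ->
  influence_rate p -> influence_rate q -> spending T sp -> spending T sq ->
  (forall M : nat, (2 <= M)%N -> bass_law T p q sp sq (P M)) ->
  evolves T f (fun t => bass_rhs p q (f t) (sp t) (sq t)) -> f 0 = 0 ->
  forall t, horizon T t ->
  is_lim_seq (fun M => expected_fraction (P M) t) (f t).
Proof.
move=> hT hp hq hsp hsq hP hf f0 t ht.
have [F [F0 hF]] := piecewise_continuous_bounded T f hT (evolves_piecewise T _ _ hf).
have [Kp [Kp0 hKp]] := piecewise_continuous_bounded T _ hT (piecewise_continuous_influence T p sp hp hsp).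
have [Kq [Kq0 hKq]] := piecewise_continuous_bounded T _ hT (piecewise_continuous_influence T q sq hq hsq).
pose K := Kp + Kq.
pose C := exp (2 * K * (1 + F) * T) * (K * (5 + 2 * F) * T).
have C0 : 0 <= C.
  apply: Rmult_le_pos; first exact: Rlt_le (exp_pos _).
  by apply: Rmult_le_pos; [apply: Rmult_le_pos|]; rewrite /K; lra.
apply/is_lim_seq_spec => eps.
have e2 : 0 < eps * eps by apply: Rmult_lt_0_compat; exact: cond_pos.
(* The error is at most [C / (INR M - 1)] for the squared difference, hence the threshold
   [eps * eps]. The shift to [N.+2] secures both [2 <= M] and [INR N < INR M - 1]. *)
have [N hN] := INR_unbounded (C / (eps * eps)).
exists (N.+2) => M /leP hM.
have hM2 : (2 <= M)%N by apply: leq_trans hM.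
have hNM : INR N < INR M - 1.
  by move/leP: hM => /le_INR; rewrite !S_INR; lra.
have hdiv : 0 <= C / (eps * eps) by apply: Rdiv_le_0_compat.
have := expected_fraction_error T K F p q sp sq f M (P M) hT hp hq hsp hsq hM2
  (hP M hM2) hf f0 hF.
have hKp' s : horizon T s -> p (sp s) <= K.
  by move=> hs; have := Rle_trans _ _ _ (Rle_abs _) (hKp s hs); rewrite /K; lra.
have hKq' s : horizon T s -> q (sq s) <= K.
  by move=> hs; have := Rle_trans _ _ _ (Rle_abs _) (hKq s hs); rewrite /K; lra.
move=> /(_ hKp' hKq' t ht); rewrite -/C.
have : C / (INR M - 1) < eps * eps.
  apply/Rlt_div_l; first lra.
  have /Rlt_div_l : C / (eps * eps) < INR M - 1 by lra.
  by move=> /(_ e2); lra.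
set x := _ - _; have := cond_pos eps; split_Rabs; nra.
Qed.

(** Probability of one given configuration with [n] adopters, not of the whole level. The factor
    [INR k.+1] counts the nodes that may have adopted last, and [M - n] counts the remaining
    nonadopters. *)
Fixpoint level_probability (p q sp sq : R -> R) (M n : nat) : R -> R :=
  linear_solution (fun t => INR (M - n) * adoption_rate p q M sp sq n t)
    (match n with
     | 0%N => fun _ => 0
     | k.+1 => fun t => INR k.+1 *
        (adoption_rate p q M sp sq k t * level_probability p q sp sq M k t)
     end)
    (match n with 0%N => 1 | _ => 0 end).

(* By symmetry the probability of a configuration depends only on its number of
   adopters, which makes the master equation a triangular linear system. *)
Lemma bass_law_level (T : R) (p q sp sq : R -> R) (M : nat) : 0 < T ->
  influence_rate p -> influence_rate q -> spending T sp -> spending T sq ->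
  bass_law T p q sp sq
    (fun A : {set 'I_M} => level_probability p q sp sq M #|A|).
Proof.
move=> hT hp hq hsp hsq.
have cst c : piecewise_continuous T (fun _ => c).
  by apply: continuous_piecewise => t; apply: continuous_const.
have rate n := adoption_rate_piecewise T p q sp sq M n hp hq hsp hsq.
have scaled c g : piecewise_continuous T g -> piecewise_continuous T (fun t => c * g t).
  exact: piecewise_continuous_op jointly_continuous_mult (cst c).
have cont n : piecewise_continuous T (level_probability p q sp sq M n).
  elim: n => [|n IH] /=; apply: evolves_piecewise; apply: evolves_linear => //;
    try exact: scaled (rate _).
  by apply: scaled; apply: (piecewise_continuous_op Rmult) => //; exact: jointly_continuous_mult.
split=> A.
  rewrite -cards_eq0; case: #|A| => [|n]; exact: linear_solution_0.
have : evolves T (level_probability p q sp sq M #|A|) (fun t =>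
    match #|A| with
     | 0%N => 0
     | k.+1 => INR k.+1 *
        (adoption_rate p q M sp sq k t * level_probability p q sp sq M k t)
    end - INR (M - #|A|) * adoption_rate p q M sp sq #|A| t
          * level_probability p q sp sq M #|A| t).
  case: #|A| => [|n]; apply: evolves_linear => //; try exact: scaled (rate _).
  by apply: scaled; apply: (piecewise_continuous_op Rmult) => //; exact: jointly_continuous_mult.
apply: evolves_ext => // t _; rewrite !sum_const.
rewrite [in INR #|~: A|]cardsCs setCK card_ord -Rmult_assoc; congr (_ - _).
have -> : \big[Rplus/0]_(j in A) (adoption_rate p q M sp sq #|A :\ j| t *
      level_probability p q sp sq M #|A :\ j| t) =
    \big[Rplus/0]_(j in A) (adoption_rate p q M sp sq #|A|.-1 t *
      level_probability p q sp sq M #|A|.-1 t).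
  by apply: eq_bigr => j hj; rewrite (cardsD1 j A) hj.
rewrite sum_const; case: #|A| => [|n] //=; change (INR 0) with 0; ring.
Qed.

(** * Adoption levels as solutions of the Bass equation *)

Lemma adoption_level_intro (T : R) (p q sp sq f : R -> R) : 0 < T ->
  influence_rate p -> influence_rate q -> spending T sp -> spending T sq ->
  evolves T f (fun t => bass_rhs p q (f t) (sp t) (sq t)) -> f 0 = 0 ->
  adoption_level T p q sp sq f.
Proof.
move=> hT hp hq hsp hsq hf f0.
exists (fun M (A : {set 'I_M}) => level_probability p q sp sq M #|A|).
have law M := bass_law_level T p q sp sq M hT hp hq hsp hsq.
by split=> [M _ //|]; apply: (mean_field_limit T p q sp sq) => // M _.
Qed.

(** Whatever laws witness [g], the mean-field limit sends their expected fractions to [f] as well,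
    and limits of sequences are unique. *)
Lemma adoption_level_unique (T : R) (p q sp sq f g : R -> R) : 0 < T ->
  influence_rate p -> influence_rate q -> spending T sp -> spending T sq ->
  evolves T f (fun t => bass_rhs p q (f t) (sp t) (sq t)) -> f 0 = 0 ->
  adoption_level T p q sp sq g -> forall t, horizon T t -> g t = f t.
Proof.
move=> hT hp hq hsp hsq hf f0 [P [hP hg]] t ht.
have h1 := is_lim_seq_unique _ _ (hg t ht).
have := is_lim_seq_unique _ _ (mean_field_limit T p q sp sq f P hT hp hq hsp hsq hP hf f0 t ht).
by rewrite h1 => -[].
Qed.

(** The odds [w = f / (1 - f)] satisfy the linear equation [w' = p + (p + q) * w]. Nonnegativity of
    [w] yields the range of [f]. *)
Lemma bass_solution_exists (T : R) (p q sp sq : R -> R) : 0 < T ->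
  influence_rate p -> influence_rate q -> spending T sp -> spending T sq ->
  exists f, evolves T f (fun t => bass_rhs p q (f t) (sp t) (sq t)) /\ f 0 = 0 /\
    forall t, horizon T t -> 0 <= f t <= 1.
Proof.
move=> hT hp hq hsp hsq.
pose P t := p (sp t); pose Q t := q (sq t).
have hP : piecewise_continuous T P := piecewise_continuous_influence T p sp hp hsp.
have hQ : piecewise_continuous T Q := piecewise_continuous_influence T q sq hq hsq.
have P0 t : horizon T t -> 0 <= P t by move=> ht; apply: hp.1; apply: hsp.2.
have Q0 t : horizon T t -> 0 <= Q t by move=> ht; apply: hq.1; apply: hsq.2.
pose a t := 0 - (P t + Q t).
have ha : piecewise_continuous T a.
  apply: (piecewise_continuous_op Rminus); first exact: jointly_continuous_minus.
    by apply: continuous_piecewise => t; apply: continuous_const.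
  exact: piecewise_continuous_op jointly_continuous_plus hP hQ.
have hw := evolves_linear T a P 0 hT ha hP.
have w0 := linear_solution_0 a P 0.
set w := linear_solution a P 0 in hw w0.
have wpos : forall t, horizon T t -> 0 <= w t.
  apply: (evolves_nonneg T w _ a hT ha hw); first by rewrite w0; lra.
  move=> t ht; have : 0 <= P t by apply: P0; rewrite /horizon; lra.
  lra.
exists (fun t => w t / (1 + w t)); split; last split; last 1 first.
- move=> t ht; have hwt := wpos t ht; split; first by apply: Rdiv_le_0_compat; lra.
  by apply/Rle_div_l; lra.
- have := evolves_comp T (fun y => y / (1 + y)) (fun y => / (1 + y) * / (1 + y)) w _ _ hw.
  have hd t : horizon T t ->
      is_derive (fun y => y / (1 + y)) (w t) (/ (1 + w t) * / (1 + w t)).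
    by move=> ht; have := wpos t ht => h; auto_derive; [lra|field; lra].
  move=> /(_ hd); apply: evolves_ext => // t ht.
  have : 0 <= w t by apply: wpos; rewrite /horizon; lra.
  by move=> h; rewrite /bass_rhs /a -/(P t) -/(Q t); field; lra.
- by rewrite w0 /Rdiv Rmult_0_l.
Qed.

(** Uniqueness for the Bass equation comes from the stochastic model: the explicit solution in the
    unit interval is an adoption level, so every other solution coincides with it. *)
Lemma bass_solution_range (T : R) (p q sp sq f : R -> R) : 0 < T ->
  influence_rate p -> influence_rate q -> spending T sp -> spending T sq ->
  evolves T f (fun t => bass_rhs p q (f t) (sp t) (sq t)) -> f 0 = 0 ->
  forall t, horizon T t -> 0 <= f t <= 1.
Proof.
move=> hT hp hq hsp hsq hf f0 t ht.
have [g [hg [g0 grange]]] := bass_solution_exists T p q sp sq hT hp hq hsp hsq.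
rewrite -(adoption_level_unique T p q sp sq f g hT hp hq hsp hsq hf f0 _ t ht); first exact: grange.
exact: adoption_level_intro hT hp hq hsp hsq hg g0.
Qed.

(** * Needle variations and the maximum principle *)

Definition discounted_income (theta gamma : R) (p q f sp sq : R -> R) (t : R) : R :=
  exp (- theta * t) * (gamma * bass_rhs p q (f t) (sp t) (sq t) - (sp t + sq t)).

Lemma continuous_discount (theta t : R) : continuous (fun s => exp (- theta * s)) t.
Proof.
by apply: (ex_derive_continuous (V := R_NormedModule)); auto_derive.
Qed.

Ltac piecewise_continuity :=
  repeat first
    [ assumption
    | apply: (piecewise_continuous_op Rminus); [exact: jointly_continuous_minus| |]
    | apply: (piecewise_continuous_op Rplus); [exact: jointly_continuous_plus| |]
    | apply: (piecewise_continuous_op Rmult); [exact: jointly_continuous_mult| |]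
    | apply: continuous_piecewise => ?; exact: continuous_discount
    | apply: continuous_piecewise => ?; exact: continuous_const ].

Lemma discounted_income_piecewise (T theta gamma : R) (p q f sp sq : R -> R) :
  influence_rate p -> influence_rate q -> spending T sp -> spending T sq ->
  piecewise_continuous T f ->
  piecewise_continuous T (discounted_income theta gamma p q f sp sq).
Proof.
move=> hp hq hsp hsq hf; rewrite /discounted_income /bass_rhs.
have [[h1 _] [h2 _]] := (hsp, hsq).
have h3 := piecewise_continuous_influence T p sp hp hsp.
have h4 := piecewise_continuous_influence T q sq hq hsq.
by piecewise_continuity.
Qed.

(** The levels [g] and [f] agree on the horizon only, so their derivatives are compared at interior
    times outside a finite set, which suffices for the integral. *)
Lemma profit_eq (T theta gamma : R) (p q sp sq f g : R -> R) : 0 < T ->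
  influence_rate p -> influence_rate q -> spending T sp -> spending T sq ->
  evolves T f (fun t => bass_rhs p q (f t) (sp t) (sq t)) -> f 0 = 0 ->
  adoption_level T p q sp sq g ->
  profit T theta gamma g sp sq =
  RInt (discounted_income theta gamma p q f sp sq) 0 T.
Proof.
move=> hT hp hq hsp hsq hf f0 hg.
have gf := adoption_level_unique T p q sp sq f g hT hp hq hsp hsq hf f0 hg.
case: (hf) => _ [l hl].
apply: is_RInt_unique; apply: (RInt_ext_finite _ _ l); first lra.
  apply: (ex_RInt_piecewise T); try lra.
  by apply: discounted_income_piecewise => //; apply: evolves_piecewise hf.
move=> t ht hn; rewrite /discounted_income; congr (_ * (_ * _ - _)).
rewrite -(is_derive_unique _ _ _ (hl t ht hn)); apply: Derive_ext_loc.
have h0 : locally t (fun y => 0 < y) by apply: open_gt; lra.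
have h1 : locally t (fun y => y < T) by apply: open_lt; lra.
by apply: filter_imp (filter_and _ _ h0 h1) => y hy; rewrite gf // /horizon; lra.
Qed.

Definition needle (a b v : R) (s : R -> R) (t : R) : R :=
  if Rle_dec a t then if Rle_dec t b then v else s t else s t.

Lemma needle_in (a b v : R) (s : R -> R) (t : R) : a <= t <= b -> needle a b v s t = v.
Proof. by move=> h; rewrite /needle; case: Rle_dec => ?; [case: Rle_dec => ?|]; rewrite /=; lra. Qed.

Lemma needle_out (a b v : R) (s : R -> R) (t : R) :
  t < a \/ b < t -> needle a b v s t = s t.
Proof. by move=> h; rewrite /needle; case: Rle_dec => ?; [case: Rle_dec => ?|]; rewrite /=; lra. Qed.

Lemma spending_needle (T a b v : R) (s : R -> R) :
  a < b -> 0 <= v -> spending T s -> spending T (needle a b v s).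
Proof.
move=> hab hv [[[l hl] [sr sl]] spos]; split; last first.
  by move=> t ht; rewrite /needle; case: Rle_dec => ? /=; [case: Rle_dec => ? //=|]; exact: spos.
have lt_loc (t c : R) : t < c -> locally t (fun y => y < c) by exact: open_lt.
have gt_loc (t c : R) : c < t -> locally t (fun y => c < y) by exact: open_gt.
have within_loc (D Q : R -> Prop) (t : R) : locally t Q -> within D (locally t) Q.
  exact: filter_le_within.
split; last split.
- exists (a :: b :: l) => t ht hn.
  have hta : t <> a by move=> e; apply: hn; left.
  have htb : t <> b by move=> e; apply: hn; right; left.
  have htl : ~ In t l by move=> h; apply: hn; right; right.
  have out : t < a \/ b < t -> locally t (fun y => y < a \/ b < y) ->
      continuous_within (horizon T) (needle a b v s) t.
    move=> h hloc; rewrite /continuous_within needle_out //.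
    apply: (filterlim_ext_loc s); last exact: hl.
    apply: filter_imp (within_loc (horizon T) _ _ hloc) => y hy.
    by rewrite needle_out.
  have [h|[h|h]] : t < a \/ b < t \/ a < t < b by lra.
  + apply: out; first by left.
    by apply: filter_imp (lt_loc t a h) => y; left.
  + apply: out; first by right.
    by apply: filter_imp (gt_loc t b h) => y; right.
  + rewrite /continuous_within needle_in; last lra.
    apply: (filterlim_ext_loc (fun _ => v)); last exact: filterlim_const.
    apply: within_loc.
    apply: filter_imp (filter_and _ _ (gt_loc t a h.1) (lt_loc t b h.2)) => y hy.
    by rewrite needle_in //; lra.
- move=> t ht; have [L hL] := sr t ht.
  have [h|[h|h]] : t < a \/ b <= t \/ a <= t < b by lra.
  + exists L; apply: (filterlim_ext_loc s) hL.
    apply: within_loc; apply: filter_imp (lt_loc t a h) => y hy.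
    by rewrite needle_out //; left.
  + exists L; apply: (filterlim_ext_loc s) hL.
    rewrite /at_right /within; apply: filter_forall => y hy.
    by rewrite needle_out //; right; lra.
  + exists v; apply: (filterlim_ext_loc (fun _ => v)); last exact: filterlim_const.
    rewrite /at_right /within; apply: filter_imp (lt_loc t b h.2) => y h1 h2.
    by rewrite needle_in //; lra.
- move=> t ht; have [L hL] := sl t ht.
  have [h|[h|h]] : b < t \/ t <= a \/ a < t <= b by lra.
  + exists L; apply: (filterlim_ext_loc s) hL.
    apply: within_loc; apply: filter_imp (gt_loc t b h) => y hy.
    by rewrite needle_out //; right.
  + exists L; apply: (filterlim_ext_loc s) hL.
    rewrite /at_left /within; apply: filter_forall => y hy.
    by rewrite needle_out //; left; lra.
  + exists v; apply: (filterlim_ext_loc (fun _ => v)); last exact: filterlim_const.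
    rewrite /at_left /within; apply: filter_imp (gt_loc t a h.1) => y h1 h2.
    by rewrite needle_in //; lra.
Qed.

Lemma Rabs_le_of_sqr (x B : R) : 0 <= B -> x * x <= B * B -> Rabs x <= B.
Proof. by move=> hB h; split_Rabs; nra. Qed.

(** The solutions coincide up to [a], separate at speed at most [2 * K] on the needle, and
    afterwards obey the same equation, so that their gap grows at most exponentially. *)
Lemma needle_deviation (T K a b : R) (p q sp sq sp1 sq1 f f1 : R -> R) : 0 < T ->
  0 <= a <= b -> b <= T ->
  (forall t, horizon T t -> 0 <= p (sp t) <= K /\ 0 <= q (sq t) <= K) ->
  (forall t, horizon T t -> 0 <= p (sp1 t) <= K /\ 0 <= q (sq1 t) <= K) ->
  (forall t, t < a \/ b < t -> sp1 t = sp t /\ sq1 t = sq t) ->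
  evolves T f (fun t => bass_rhs p q (f t) (sp t) (sq t)) ->
  evolves T f1 (fun t => bass_rhs p q (f1 t) (sp1 t) (sq1 t)) ->
  f1 0 = f 0 ->
  (forall t, horizon T t -> 0 <= f t <= 1) ->
  (forall t, horizon T t -> 0 <= f1 t <= 1) ->
  forall t, horizon T t -> Rabs (f1 t - f t) <= exp (K * T) * (2 * K * (b - a)).
Proof.
move=> hT hab hbT hK hK1 out hf hf1 f01 fr fr1.
have K0 : 0 <= K by have [|h _] := hK 0; rewrite /horizon; lra.
have hd := evolves_minus T _ _ _ _ hf1 hf.
have hdd := evolves_mult T _ _ _ _ hd hd.
(* Under equal controls the right-hand sides at [y] and [x] differ by
   [(q - p - q * (x + y)) * (y - x)]. Squaring the gap makes the one-sided Gronwall bound control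
   both signs. *)
have growth u v : 0 <= u <= v -> v <= T ->
    (forall t, u < t < v -> t < a \/ b < t) ->
    (f1 v - f v) * (f1 v - f v) <=
    exp (2 * K * (v - u)) * ((f1 u - f u) * (f1 u - f u)).
  move=> huv hv h.
  have := evolves_gronwall T _ _ (2 * K) 0 u v hdd huv hv.
  rewrite Rmult_0_l Rplus_0_r; apply; try lra.
  move=> t ht; have ht' : horizon T t by rewrite /horizon; lra.
  have [-> ->] := out t (h t ht).
  have [[p0 pK] [q0 qK]] := hK t ht'.
  have := fr t ht'; have := fr1 t ht'; rewrite /bass_rhs; move: (f1 t) (f t) => y x hy hx.
  have -> : ((1 - y) * (p (sp t) + q (sq t) * y) - (1 - x) * (p (sp t) + q (sq t) * x)) *
     (y - x) + (y - x) * ((1 - y) * (p (sp t) + q (sq t) * y) -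
       (1 - x) * (p (sp t) + q (sq t) * x)) =
     2 * (q (sq t) - p (sp t) - q (sq t) * (x + y)) * ((y - x) * (y - x)) by ring.
  rewrite Rplus_0_r; apply: Rmult_le_compat_r; first exact: Rle_0_sqr.
  by have : 0 <= q (sq t) * (x + y); [apply: Rmult_le_pos; lra|lra].
have before t : 0 <= t <= a -> f1 t - f t = 0.
  move=> ht; have := growth 0 t (conj (Rle_refl 0) ht.1).
  have tT : t <= T by lra.
  have tl s : 0 < s < t -> s < a \/ b < s by move=> hs; left; lra.
  move=> /(_ tT tl); rewrite f01 Rminus_diag Rmult_0_r Rmult_0_r => h.
  by have := Rle_0_sqr (f1 t - f t); rewrite /Rsqr => h'; nra.
have inside t : a <= t <= b -> Rabs (f1 t - f t) <= 2 * K * (b - a).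
  move=> ht; have e0 := before a (conj hab.1 (Rle_refl a)).
  have rhs s : a < s < t -> - (2 * K) <= bass_rhs p q (f1 s) (sp1 s) (sq1 s)
      - bass_rhs p q (f s) (sp s) (sq s) <= 2 * K.
    move=> hs; have hs' : horizon T s by rewrite /horizon; lra.
    have [[p0 pK] [q0 qK]] := hK s hs'; have [[p0' pK'] [q0' qK']] := hK1 s hs'.
    have bd x P Q : 0 <= x <= 1 -> 0 <= P <= K -> 0 <= Q <= K ->
        0 <= (1 - x) * (P + Q * x) <= 2 * K.
      move=> hx hP hQ; have : 0 <= Q * x <= K by nra.
      by move=> h; split; [apply: Rmult_le_pos; lra|nra].
    have := bd _ _ _ (fr s hs') (hK s hs').1 (hK s hs').2.
    have := bd _ _ _ (fr1 s hs') (hK1 s hs').1 (hK1 s hs').2.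
    by rewrite /bass_rhs; lra.
  have h1 := evolves_mean_ge T _ _ (- (2 * K)) a t hd.
  have h2 := evolves_mean_le T _ _ (2 * K) a t hd.
  have {}h1 : - (2 * K) * (t - a) <= f1 t - f t - (f1 a - f a).
    by apply: h1; try lra; move=> s hs; apply: (rhs s hs).1.
  have {}h2 : f1 t - f t - (f1 a - f a) <= (2 * K) * (t - a).
    by apply: h2; try lra; move=> s hs; apply: (rhs s hs).2.
  by apply: Rabs_le; nra.
have B0 : 0 <= 2 * K * (b - a) by apply: Rmult_le_pos; lra.
have E1 : 1 <= exp (K * T) by rewrite -exp_0; apply: exp_monotone; nra.
move=> t ht; have ht' : 0 <= t <= T := ht.
have [h|[h|h]] : t <= a \/ a <= t <= b \/ b <= t by lra.
- by rewrite before ?Rabs_R0; [apply: Rmult_le_pos; lra|lra].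
- by have := inside t h; nra.
apply: Rabs_le_of_sqr; first by apply: Rmult_le_pos; lra.
apply: (Rle_trans _ (exp (2 * K * (t - b)) * ((f1 b - f b) * (f1 b - f b)))).
  by apply: growth; try lra; move=> s hs; right; lra.
have -> : exp (K * T) * (2 * K * (b - a)) * (exp (K * T) * (2 * K * (b - a))) =
  exp (2 * K * T) * ((2 * K * (b - a)) * (2 * K * (b - a))).
  have -> : 2 * K * T = K * T + K * T by ring.
  by rewrite exp_plus; ring.
apply: Rmult_le_compat.
- exact: Rlt_le (exp_pos _).
- exact: Rle_0_sqr.
- by apply: exp_monotone; apply: Rmult_le_compat_l; lra.
- have : Rabs (f1 b - f b) <= 2 * K * (b - a) by apply: inside; lra.
  by move=> h'; apply: Rsqr_le_abs_1; rewrite (Rabs_pos_eq (2 * K * (b - a))).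
Qed.

Ltac within_continuity :=
  repeat first
    [ assumption
    | apply: (continuous_within_op Rminus); [exact: jointly_continuous_minus| |]
    | apply: (continuous_within_op Rplus); [exact: jointly_continuous_plus| |]
    | apply: (continuous_within_op Rmult); [exact: jointly_continuous_mult| |]
    | apply: continuous_continuous_within; exact: continuous_discount
    | apply: continuous_continuous_within; exact: continuous_const ].

Lemma hamiltonian_continuous (T theta gamma : R) (p q f Psi sp sq : R -> R) (t : R) :
  influence_rate p -> influence_rate q -> spending T sp -> spending T sq ->
  horizon T t ->
  continuous_within (horizon T) f t -> continuous_within (horizon T) Psi t ->
  continuous_within (horizon T) sp t -> continuous_within (horizon T) sq t ->
  continuous_within (horizon T)
    (fun s => hamiltonian theta gamma p q s (f s) (Psi s) (sp s) (sq s)) t.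
Proof.
move=> hp hq hsp hsq ht cf cPsi csp csq; rewrite /hamiltonian /bass_rhs.
have h3 := continuous_within_influence T p sp t hp hsp ht csp.
have h4 := continuous_within_influence T q sq t hq hsq ht csq.
by within_continuity.
Qed.

Lemma spending_const (T v : R) : 0 <= v -> spending T (fun _ => v).
Proof.
by move=> hv; split=> // ; apply: continuous_piecewise => t; apply: continuous_const.
Qed.

(* The costate equation cancels the terms of first order in [f1 - f] wherever
   the two controls agree. *)
Lemma gain_density_eq (theta gamma : R) (p q : R -> R) (t f f1 Psi sp sq sp1 sq1 : R) :
  exp (- theta * t) * (gamma * bass_rhs p q f1 sp1 sq1 - (sp1 + sq1))
  - exp (- theta * t) * (gamma * bass_rhs p q f sp sq - (sp + sq))
  + (costate_rhs theta gamma p q t f Psi sp sq * (f1 - f)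
     + Psi * (bass_rhs p q f1 sp1 sq1 - bass_rhs p q f sp sq)) =
  hamiltonian theta gamma p q t f Psi sp1 sq1 - hamiltonian theta gamma p q t f Psi sp sq
  + (gamma * exp (- theta * t) + Psi) * (f1 - f) *
      ((q sq1 - q sq) * (1 - 2 * f) - (p sp1 - p sp))
  - (gamma * exp (- theta * t) + Psi) * q sq1 * ((f1 - f) * (f1 - f)).
Proof. by rewrite /hamiltonian /costate_rhs /bass_rhs; ring. Qed.

Lemma Rabs_mult_le (x y X Y : R) : Rabs x <= X -> Rabs y <= Y -> Rabs (x * y) <= X * Y.
Proof.
by move=> hx hy; rewrite Rabs_mult; apply: Rmult_le_compat; (exact: Rabs_pos) || assumption.
Qed.

Lemma maximum_principle (T theta gamma : R) (p q sp sq f Psi : R -> R) (t0 vp vq : R) :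
  0 < T -> influence_rate p -> influence_rate q ->
  optimal_promotion T theta gamma p q sp sq ->
  bass_bvp T theta gamma p q sp sq f Psi ->
  horizon T t0 -> continuous_within (horizon T) sp t0 ->
  continuous_within (horizon T) sq t0 -> 0 <= vp -> 0 <= vq ->
  hamiltonian theta gamma p q t0 (f t0) (Psi t0) vp vq <=
  hamiltonian theta gamma p q t0 (f t0) (Psi t0) (sp t0) (sq t0).
Proof.
move=> hT hp hq [hsp [hsq [g [hg opt]]]] [hf [f0 [hPsi PsiT]]] ht0 csp csq hvp hvq.
apply: Rnot_lt_le => hlt.
pose H t x y := hamiltonian theta gamma p q t (f t) (Psi t) x y.
(* The assumed gain of the Hamiltonian at [t0] persists, by continuity, at half its size near [t0];
   the needle is placed there. *)
pose G t := H t vp vq - H t (sp t) (sq t).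
have G0 : 0 < G t0 by rewrite /G /H; lra.
have cG : continuous_within (horizon T) G t0.
  apply: (continuous_within_op Rminus); first exact: jointly_continuous_minus.
    apply: (hamiltonian_continuous T theta gamma p q f Psi (fun _ => vp) (fun _ => vq)) => //;
      try exact: spending_const; try exact: hf.1; try exact: hPsi.1;
      by apply: continuous_continuous_within; apply: continuous_const.
  by apply: hamiltonian_continuous => //; [exact: hf.1|exact: hPsi.1].
pose eta := G t0 / 2.
have eta0 : 0 < eta by rewrite /eta; lra.
have [eps heps] : exists eps : posreal, forall t, Rabs (t - t0) < eps -> horizon T t -> eta < G t.
  have := cG (fun y => eta < y); rewrite /filtermap /within => h.
  have [|eps heps] := h; first by apply: open_gt; rewrite /eta; lra.
  by exists eps => t; apply: heps.
have [Kp [Kp0 hKp]] := piecewise_continuous_bounded T _ hT (piecewise_continuous_influence T p sp hp hsp).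
have [Kq [Kq0 hKq]] := piecewise_continuous_bounded T _ hT (piecewise_continuous_influence T q sq hq hsq).
have pvp := hp.1 vp hvp; have qvq := hq.1 vq hvq.
pose K := Kp + Kq + p vp + q vq.
have K0 : 0 <= K by rewrite /K; lra.
have hK t : horizon T t -> 0 <= p (sp t) <= K /\ 0 <= q (sq t) <= K.
  move=> ht; have := hp.1 _ (hsp.2 t ht); have := hq.1 _ (hsq.2 t ht).
  have := Rle_trans _ _ _ (Rle_abs _) (hKp t ht).
  by have := Rle_trans _ _ _ (Rle_abs _) (hKq t ht); rewrite /K; lra.
pose mu t := gamma * exp (- theta * t) + Psi t.
have hmu : piecewise_continuous T mu.
  by have hPsi' := evolves_piecewise T _ _ hPsi; rewrite /mu; piecewise_continuity.
have [B [B0 hB]] := piecewise_continuous_bounded T mu hT hmu.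
pose C := exp (K * T) * (2 * K).
have C0 : 0 <= C by apply: Rmult_le_pos; [exact: Rlt_le (exp_pos _)|lra].
(* With a gap of at most [C * h], the error terms of [gain_density_eq] are at most [E1 * h] (linear
   in the gap, present only on the needle) and [E2 * (h * h)] (quadratic, present everywhere). *)
pose E1 := B * C * (4 * K); pose E2 := B * K * (C * C).
have E10 : 0 <= E1 by apply: Rmult_le_pos; [exact: Rmult_le_pos|lra].
have E20 : 0 <= E2 by apply: Rmult_le_pos; exact: Rmult_le_pos.
(* The needle length stays within the neighbourhood of [t0], fits into the horizon on one side of
   [t0], and makes the accumulated errors smaller than [eta]. *)
pose h := Rmin (Rmin (eps / 2) (T / 2)) (eta / (2 * (E1 + E2 * T + 1))).
have E0 : 0 <= E2 * T by apply: Rmult_le_pos; lra.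
have h0 : 0 < h.
  by repeat apply: Rmin_pos; try lra; [have := cond_pos eps; lra|apply: Rdiv_lt_0_compat; lra].
have heps2 : h <= eps / 2 by apply: Rle_trans (Rmin_l _ _) (Rmin_l _ _).
have hT2 : h <= T / 2 by apply: Rle_trans (Rmin_l _ _) (Rmin_r _ _).
have hsmall : h * (E1 + E2 * T) < eta.
  have /Rle_div_r : h <= eta / (2 * (E1 + E2 * T + 1)) := Rmin_r _ _.
  by move=> hh; have {}hh : h * (2 * (E1 + E2 * T + 1)) <= eta by [apply: hh; lra]; nra.
have [a [b [hab [hbT [bah near]]]]] : exists a b, 0 <= a < b /\ b <= T /\ b - a = h /\
    forall t, a <= t <= b -> Rabs (t - t0) < eps.
  rewrite /horizon in ht0; have := cond_pos eps => ep.
  (* The needle starts at [t0] if it fits before [T], and otherwise ends there; [h <= T / 2] then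
     keeps it after time 0. *)
  case: (Rle_dec (t0 + h) T) => hc.
    exists t0, (t0 + h); split; first lra; split; first lra; split; first lra.
    by move=> t ht; rewrite Rabs_pos_eq; lra.
  exists (t0 - h), t0; split; first lra; split; first lra; split; first lra.
  by move=> t ht; split_Rabs; lra.
pose sp1 := needle a b vp sp; pose sq1 := needle a b vq sq.
have hsp1 : spending T sp1 by apply: spending_needle => //; lra.
have hsq1 : spending T sq1 by apply: spending_needle => //; lra.
have out t : t < a \/ b < t -> sp1 t = sp t /\ sq1 t = sq t.
  by move=> ht; rewrite /sp1 /sq1 !needle_out.
have hK1 t : horizon T t -> 0 <= p (sp1 t) <= K /\ 0 <= q (sq1 t) <= K.
  move=> ht; have [ht'|ht'] : (t < a \/ b < t) \/ a <= t <= b by lra.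
    by have [-> ->] := out t ht'; apply: hK.
  by rewrite /sp1 /sq1 !needle_in // /K; lra.
have [f1 [hf1 [f10 fr1]]] := bass_solution_exists T p q sp1 sq1 hT hp hq hsp1 hsq1.
have fr := bass_solution_range T p q sp sq f hT hp hq hsp hsq hf f0.
have dev t : horizon T t -> Rabs (f1 t - f t) <= C * h.
  move=> ht; have -> : C * h = exp (K * T) * (2 * K * (b - a)) by rewrite /C bah; ring.
  by apply: (needle_deviation T K a b p q sp sq sp1 sq1) => //; [lra|rewrite f0].
have hg1 := adoption_level_intro T p q sp1 sq1 f1 hT hp hq hsp1 hsq1 hf1 f10.
have := opt sp1 sq1 f1 hsp1 hsq1 hg1.
rewrite (profit_eq T theta gamma p q sp sq f g) // (profit_eq T theta gamma p q sp1 sq1 f1 f1) //.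
have hI := discounted_income_piecewise T theta gamma p q f sp sq hp hq hsp hsq (evolves_piecewise T _ _ hf).
have hI1 := discounted_income_piecewise T theta gamma p q f1 sp1 sq1 hp hq hsp1 hsq1 (evolves_piecewise T _ _ hf1).
have hD := evolves_plus T _ _ _ _
  (evolves_minus T _ _ _ _ (evolves_primitive T _ hT hI1) (evolves_primitive T _ hT hI))
  (evolves_mult T _ _ _ _ hPsi (evolves_minus T _ _ _ _ hf1 hf)).
have low t : horizon T t -> - (E2 * (h * h)) <= - (mu t * q (sq1 t) * ((f1 t - f t) * (f1 t - f t))).
  move=> ht; apply: Ropp_le_contravar; apply: Rle_trans (Rle_abs _) _.
  have -> : E2 * (h * h) = B * K * ((C * h) * (C * h)) by rewrite /E2; ring.
  apply: Rabs_mult_le; apply: Rabs_mult_le; try exact: dev; first exact: hB.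
  by rewrite Rabs_pos_eq; have := (hK1 t ht).2; lra.
(* Running profit difference plus [Psi * (f1 - f)]. The added product vanishes at 0, where the
   levels agree, and at [T], where [Psi] is zero, so [D T] is the exact change of profit. *)
pose D t := RInt (discounted_income theta gamma p q f1 sp1 sq1) 0 t -
  RInt (discounted_income theta gamma p q f sp sq) 0 t + Psi t * (f1 t - f t).
have outside u v : 0 <= u <= v -> v <= T -> (forall t, u < t < v -> t < a \/ b < t) ->
    - (E2 * (h * h)) * (v - u) <= D v - D u.
  move=> huv hv ho; apply: (evolves_mean_ge T _ _ _ u v hD huv hv) => t ht.
  have ht' : horizon T t by rewrite /horizon; lra.
  rewrite /discounted_income gain_density_eq -/(mu t).
  have := low t ht'; have [-> ->] := out t (ho t ht); lra.
have inside : (eta - E1 * h - E2 * (h * h)) * (b - a) <= D b - D a.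
  apply: (evolves_mean_ge T _ _ _ a b hD) => //; first lra.
  move=> t ht; have ht' : horizon T t by rewrite /horizon; lra.
  rewrite /discounted_income gain_density_eq -/(mu t).
  have := low t ht'.
  have : eta < G t by apply: heps => //; apply: near; lra.
  have : Rabs (mu t * (f1 t - f t) *
      ((q (sq1 t) - q (sq t)) * (1 - 2 * f t) - (p (sp1 t) - p (sp t)))) <= E1 * h.
    have -> : E1 * h = B * (C * h) * (4 * K) by rewrite /E1; ring.
    apply: Rabs_mult_le; first by apply: Rabs_mult_le; [exact: hB|exact: dev].
    have [hp1 hq1] := hK1 t ht'; have [hp2 hq2] := hK t ht'; have hft := fr t ht'.
    have : Rabs ((q (sq1 t) - q (sq t)) * (1 - 2 * f t)) <= K * 1.
      by apply: Rabs_mult_le; apply: Rabs_le; lra.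
    by move/Rabs_le_between => hh; apply: Rabs_le; lra.
  have -> : sp1 t = vp by apply: needle_in; lra.
  have -> : sq1 t = vq by apply: needle_in; lra.
  by move/Rabs_le_between; rewrite /G /H; lra.
have o1 : - (E2 * (h * h)) * (a - 0) <= D a - D 0.
  by apply: outside; try lra; move=> t ht; left; lra.
have o2 : - (E2 * (h * h)) * (T - b) <= D T - D b.
  by apply: outside; try lra; move=> t ht; right; lra.
have D0 : D 0 = 0 by rewrite /D !RInt_point f10 f0 /zero /=; ring.
have DT : D T = RInt (discounted_income theta gamma p q f1 sp1 sq1) 0 T -
  RInt (discounted_income theta gamma p q f sp sq) 0 T by rewrite /D PsiT; ring.
have : 0 < D T; last lra.
(* Summing the three pieces gives [D T >= h * (eta - h * (E1 + E2 * T))], which is positive and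
   contradicts optimality. *)
have := Rmult_lt_compat_l h _ _ h0 hsmall.
have eb : T - b = T - a - h by lra.
rewrite bah in inside; rewrite eb in o2; lra.
Qed.

(** * Stationarity of the Hamiltonian and solvability of the boundary-value problem *)

Lemma is_derive_interior_max (F : R -> R) (c : R) :
  0 < c -> ex_derive F c -> (forall x, 0 <= x -> F x <= F c) -> is_derive F c 0.
Proof.
move=> hc hF hmax; have pr : derivable_pt F c by apply/ex_derive_Reals_0.
(* The interval from 0 to [2 * c] surrounds [c] and stays inside the half-line where [c] is known to
   be a maximizer. *)
have := deriv_maximum F 0 (2 * c) c pr hc; rewrite Derive_Reals => h.
have {h} <- : Derive F c = 0.
  by apply: h; [lra|move=> x hx _; apply: hmax; lra].
exact: Derive_correct.
Qed.

(** For given controls the state equation does not involve [Psi], and the costate equation is linear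
    in it. The problem decouples, and the terminal condition becomes a choice of initial value. *)
Lemma bass_bvp_exists (T theta gamma : R) (p q sp sq : R -> R) : 0 < T ->
  influence_rate p -> influence_rate q -> spending T sp -> spending T sq ->
  exists f Psi, bass_bvp T theta gamma p q sp sq f Psi.
Proof.
move=> hT hp hq hsp hsq.
have [f [hf [f0 _]]] := bass_solution_exists T p q sp sq hT hp hq hsp hsq.
have hcf := evolves_piecewise T _ _ hf.
have h1 := piecewise_continuous_influence T p sp hp hsp.
have h2 := piecewise_continuous_influence T q sq hq hsq.
pose c t := p (sp t) + q (sq t) * (2 * f t - 1).
have hc : piecewise_continuous T c by rewrite /c; piecewise_continuity.
have ha : piecewise_continuous T (fun t => 0 - c t) by piecewise_continuity.
pose b t := gamma * exp (- theta * t) * c t.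
have hb : piecewise_continuous T b by rewrite /b; piecewise_continuity.
(* The initial value making the linear solution vanish at the final time. *)
pose y0 := - RInt (fun s => exp (RInt (fun t => 0 - c t) 0 s) * b s) 0 T.
exists f, (linear_solution (fun t => 0 - c t) b y0); split=> //; split=> //; split.
  apply: evolves_ext (evolves_linear T _ b y0 hT ha hb) => // t _.
  by rewrite /costate_rhs /b /c; ring.
by rewrite /linear_solution /y0 Rplus_opp_l Rmult_0_r.
Qed.

(** At a positive spending the maximum of the Hamiltonian is interior, so its derivative vanishes.
    At zero spending the maximum lies on the boundary, where the derivative may be nonzero or fail
    to exist. *)
Theorem theorem4 (T theta gamma : R) (p q : R -> R) (sp sq : R -> R)
    (hT : 0 < T) (hp : influence_rate p) (hq : influence_rate q)
    (hopt : optimal_promotion T theta gamma p q sp sq) :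
  (exists f Psi : R -> R, bass_bvp T theta gamma p q sp sq f Psi) /\
  (forall f Psi : R -> R, bass_bvp T theta gamma p q sp sq f Psi ->
   forall t : R, horizon T t ->
     continuous_within (horizon T) sp t ->
     continuous_within (horizon T) sq t ->
     (0 < sp t ->
        is_derive (fun x => hamiltonian theta gamma p q t (f t) (Psi t) x (sq t))
          (sp t) 0) /\
     (0 < sq t ->
        is_derive (fun x => hamiltonian theta gamma p q t (f t) (Psi t) (sp t) x)
          (sq t) 0)).
Proof.
have [hsp [hsq _]] := hopt; split; first exact: bass_bvp_exists.
move=> f Psi hbvp t ht csp csq.
have max := maximum_principle T theta gamma p q sp sq f Psi t _ _ hT hp hq hopt hbvp ht csp csq.
split=> hpos; apply: is_derive_interior_max => //.
- rewrite /hamiltonian /bass_rhs; have := hp.2.2 _ hpos => hd; by auto_derive.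
- by move=> x hx; apply: max => //; apply: hsq.2.
- rewrite /hamiltonian /bass_rhs; have := hq.2.2 _ hpos => hd; by auto_derive.
- by move=> x hx; apply: max => //; apply: hsp.2.
Qed.
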